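(* Let $m,n\ge 1$ and $r\ge 1$, let $\Gamma\subset\Sigma$ be an $(m,n,r)$-ribbon graph, and let $g$ be the genus of $\Sigma$ (so $r=2g-2+m+n$). Then there exist an $(m,n,r)$-tropical graph $\Gamma'$ and a $\mathbb{Z}$-linear map $\varphi:\mathbb{Z}[E(\Gamma)]\to\mathbb{Z}[E(\Gamma')]$, both depending only on $\Gamma$, such that for all partitions $\mu,\nu$ of a common integer $d$ with lengths $m$ and $n$, and every positive $(\mu,\nu)$-balanced edge weighting $w$ of $\Gamma$, the tropicalization of the $(\mu,\nu,g)$-Hurwitz ribbon graph $(\Gamma,w)$ is a $(\mu,\nu,g)$-monodromy graph isomorphic to $\Gamma'$ with edge weighting $\varphi(w)$. Moreover, $\varphi$ has the form $$\varphi(w)(e')=\sum_{e\in S(e')}w(e),\qquad e'\in E(\Gamma'),$$ for certain subsets $S(e')\subset E(\Gamma)$.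
   Context: Ribbon graphs. A ribbon graph is a pair $\Gamma\subset\Sigma$ of a graph $\Gamma$ (loops and multiple edges allowed) embedded in a closed connected oriented topological surface $\Sigma$ such that each component of $\Sigma\setminus\Gamma$ (a face) is an open disk. It is bicolored if its faces are colored gray and white so that each edge separates a gray face from a white face. The natural orientation of an edge is the one for which, traveling along the edge, the gray face is on the right and the white face is on the left. An $(m,n,r)$-ribbon graph is a bicolored ribbon graph all of whose vertices are 4-valent, with $r$ vertices labeled $1,\dots,r$, with $m$ white faces labeled $1,\dots,m$ and with $n$ gray faces labeled $1,\dots,n$. An edge weighting $w$ of it is positive if $w(e)$ is a nonnegative integer for every edge $e$, and $w(e)>0$ whenever $e$ is naturally oriented from vertex $i$ to vertex $j$ with $i\ge j$. It is $(\mu,\nu)$-balanced if, for each $i$, the sum of $w(e)$ over the edges $e$ incident to the $i$th white face is $\mu_i$ and, for each $j$, the sum of $w(e)$ over the edges incident to the $j$th gray face is $\nu_j$. A $(\mu,\nu,g)$-Hurwitz ribbon graph is an $(m,n,r)$-ribbon graph, $r=2g-2+m+n$, with a positive $(\mu,\nu)$-balanced edge weighting. $E(\cdot)$ denotes the set of edges of a graph and $\mathbb{Z}[E]$ the lattice of $\mathbb{Z}$-linear combinations of edges; edge weightings are identified with elements of this lattice. Tropical and monodromy graphs. An $(m,n,r)$-tropical graph is a directed graph with $m$ univalent sources labeled $1,\dots,m$, $n$ univalent sinks labeled $1,\dots,n$, and $r$ trivalent vertices labeled $1,\dots,r$, such that an edge from trivalent vertex $i$ to trivalent vertex $j$ exists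 only if $i<j$. A $(\mu,\nu,g)$-monodromy graph is an $(m,n,r)$-tropical graph with nonnegative integer edge weights such that the edge at the $i$th source has weight $\mu_i$, the edge at the $j$th sink has weight $\nu_j$, and at each trivalent vertex the sum of the weights of the incoming edges equals the sum of the weights of the outgoing edges. Isomorphisms are isomorphisms of directed graphs preserving vertex labels and edge weights. Tropicalization of a Hurwitz ribbon graph $(\Gamma,w)$. Place $w(e)$ tick marks in the interior of each edge $e$ and label the resulting $d$ tick marks by $\{1,\dots,d\}$ arbitrarily. For $0\le i\le r$ let $\sigma_i$ be the permutation of the tick marks sending $x$ to the next tick mark reached when traveling from $x$ along the natural orientation of the edges, where at each vertex one turns left onto the adjacent outgoing edge if the vertex label is greater than $i$, and right onto the adjacent outgoing edge if the vertex label is at most $i$. The cycles of $\sigma_0$ correspond to the white faces, the cycles of $\sigma_r$ correspond to the gray faces, and $\sigma_i=\tau_i\sigma_{i-1}$ with $\tau_i$ a transposition, so that passing from $\sigma_{i-1}$ to $\sigma_i$ either joins two cycles into one or cuts one cycle into two, leaving all other cycles unchanged. The tropicalization is the directed weighted graph whose edges are the equivalence classes of pairs $(i,c)$, with $c$ a cycle (fixed points included) of $\sigma_i$, under the relation generated by $(i-1,c)\sim(i,c)$ whenever $c$ is a cycle of both $\sigma_{i-1}$ and $\sigma_i$; the weight of an edge is the length of the cycle $c$. The trivalent vertex labeled $i$ has as incoming edges the classes of the cycles of $\sigma_{i-1}$ that are joined or cut by $\tau_i$ and as outgoing edges the classes of the resulting cycles of $\sigma_i$. The edge of the cycle of $\sigma_0$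 coming from the $k$th white face starts at the $k$th source, and the edge of the cycle of $\sigma_r$ coming from the $k$th gray face ends at the $k$th sink. *)

(* Defs.v *)
From HB Require Import structures.
From mathcomp Require Import all_boot all_order all_fingroup all_algebra.

Set Implicit Arguments.
Unset Strict Implicit.
Unset Printing Implicit Defensive.

Import Order.TTheory GRing.Theory Num.Theory.

Local Open Scope nat_scope.

(* A graph cellularly embedded in a closed connected oriented surface is       *)
(* encoded, as usual, by its combinatorial map.  The darts are the oriented    *)
(* edges, each attached to the vertex it leaves; [vrot x] is the next dart     *)
(* after x in counterclockwise order around that vertex and [drev x] is x with *)
(* the opposite orientation.  Vertices and edges are the orbits of vrot and    *)
(* drev.  (The edgeless graph on the sphere, which has no 4-valent vertex, is  *)
(* the only ribbon graph that is not represented.)                             *)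
Record ribbon_graph := RibbonGraph {
  dart : finType;
  vrot : {perm dart};
  drev : {perm dart};
  drev_involutive : involutive drev;
  drev_free : forall x, drev x != x;
  ribbon_connected :
    forall x y, connect (fun a b => (b == vrot a) || (b == drev a)) x y
}.

(* After travelling along x, turning left as sharply as possible means leaving *)
(* along the dart that precedes [drev x] counterclockwise: this follows the    *)
(* boundary of the face on the left of x.  Faces are the orbits of fnext, and  *)
(* x belongs to the face on its left.                                          *)
Definition fnext (G : ribbon_graph) : {perm dart G} :=
  (drev G * (vrot G)^-1)%g.

(* V - E + F = 2 - 2g                                                          *)
Definition is_genus (G : ribbon_graph) (g : nat) : Prop :=
  #|porbits (vrot G)| + #|porbits (fnext G)| + 2 * g
    = #|porbits (drev G)| + 2.

(* Labels start at 0: the labels 1, ..., r of the text are the elements        *)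
(* 0, ..., r - 1 of 'I_r, and likewise for faces.  The labelings are functions *)
(* on darts that induce bijections from the vertices to 'I_r and from the      *)
(* faces to 'I_m + 'I_n, the left summand being the labels of the white faces  *)
(* and the right one those of the gray faces.                                  *)
Record mnr_ribbon_graph (m n r : nat) := MnrRibbonGraph {
  underlying :> ribbon_graph;
  vlabel : dart underlying -> 'I_r;
  vlabelP :
    forall x y, (vlabel x == vlabel y) = (y \in porbit (vrot underlying) x);
  vlabel_onto : forall i, exists x, vlabel x = i;
  flabel : dart underlying -> ('I_m + 'I_n)%type;
  flabelP :
    forall x y, (flabel x == flabel y) = (y \in porbit (fnext underlying) x);
  flabel_onto : forall k, exists x, flabel x = k;
  bicolored :
    forall x, is_inl (flabel (drev underlying x)) = ~~ is_inl (flabel x);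
  four_valent : forall x, #|porbit (vrot underlying) x| = 4
}.

Section RibbonGraphs.

Variables (m n r : nat) (G : mnr_ribbon_graph m n r).

(* An edge is represented by its dart in the natural orientation, the one with *)
(* a white face on its left.                                                   *)
Definition edge : finType := {x : dart G | is_inl (flabel x)}.

Definition tail_label (e : edge) : 'I_r := vlabel (val e).
Definition head_label (e : edge) : 'I_r := vlabel (drev G (val e)).

Definition in_white_face (i : 'I_m) (e : edge) : bool :=
  flabel (val e) == inl i.
Definition in_gray_face (j : 'I_n) (e : edge) : bool :=
  flabel (drev G (val e)) == inr j.

Lemma flabel_fnext x : flabel (fnext G x) = flabel x :> 'I_m + 'I_n.
Proof. by apply/esym/eqP; rewrite flabelP -{1}[fnext G]expg1 mem_porbit. Qed.

Lemma white_turn_left (x : dart G) :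
  is_inl (flabel x) -> is_inl (flabel ((vrot G)^-1%g (drev G x))).
Proof. by rewrite -{1}flabel_fnext permM. Qed.

Lemma white_turn_right (x : dart G) :
  is_inl (flabel x) -> is_inl (flabel (vrot G (drev G x))).
Proof.
set y := vrot G _ => wx; rewrite -[flabel y]flabel_fnext.
have := flabel_fnext (drev G y); rewrite permM drev_involutive permK => E.
have := bicolored (drev G y); rewrite drev_involutive -E bicolored wx /=.
by rewrite flabel_fnext.
Qed.

Definition turn_left (e : edge) : edge :=
  exist _ ((vrot G)^-1%g (drev G (val e))) (white_turn_left (valP e)).
Definition turn_right (e : edge) : edge :=
  exist _ (vrot G (drev G (val e))) (white_turn_right (valP e)).

(* [(head_label e).+1] is the label of the head of e in the numbering from 1.  *)
Definition turn (i : nat) (e : edge) : edge :=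
  if i < (head_label e).+1 then turn_left e else turn_right e.

(* Elements of the lattice Z[E].                                               *)
Definition weighting := {ffun edge -> int^o}.

Definition positive_weighting (w : weighting) : Prop :=
  (forall e, 0 <= w e :> int)%R /\
  (forall e, head_label e <= tail_label e -> (0 < w e :> int)%R).

Definition balanced_weighting (mu : m.-tuple nat) (nu : n.-tuple nat)
    (w : weighting) : Prop :=
  (forall i, (\sum_(e | in_white_face i e) w e = (tnth mu i)%:Z)%R) /\
  (forall j, (\sum_(e | in_gray_face j e) w e = (tnth nu j)%:Z)%R).

Lemma vlabel_vrot x : vlabel (vrot G x) = vlabel x :> 'I_r.
Proof. by apply/esym/eqP; rewrite vlabelP -{1}[vrot G]expg1 mem_porbit. Qed.

Lemma tail_turn i e : tail_label (turn i e) = head_label e.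
Proof.
rewrite /turn; case: ifP => _; rewrite /tail_label /= ?vlabel_vrot //.
by rewrite -[LHS]vlabel_vrot permKV.
Qed.

Lemma turn_inj i : injective (turn i).
Proof.
move=> e f ef; have E : head_label e = head_label f by rewrite -!(tail_turn i) ef.
move: ef; rewrite /turn E; case: ifP => _ /(congr1 val) /= /perm_inj /perm_inj;
  exact: val_inj.
Qed.

Section Ticks.

Variable w : weighting.

Definition tick : finType := {e : edge & 'I_(absz (w e))}.

Definition tick_edge (x : tick) : edge := tag x.
Definition tick_pos (x : tick) : nat := tagged x.

(* The tick mark in position k of the edge e; x is a dummy default value.      *)
Definition tick_at (x : tick) (e : edge) (k : nat) : tick :=
  if insub k is Some k' then Tagged (fun e => 'I_(absz (w e))) (k' : 'I_(absz (w e)))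
  else x.

(* The first edge carrying a tick mark that is met when leaving e and making   *)
(* the turns prescribed by i.  As turn i is a permutation of the edges, the    *)
(* search comes back to e, so it succeeds if e carries a tick mark.            *)
Definition next_edge (i : nat) (e : edge) : edge :=
  let s := traject (turn i) (turn i e) #|edge| in
  nth e s (find (fun f => 0 < absz (w f)) s).

Definition next_tick (i : nat) (x : tick) : tick :=
  if (tick_pos x).+1 < absz (w (tick_edge x))
  then tick_at x (tick_edge x) (tick_pos x).+1
  else tick_at x (next_edge i (tick_edge x)) 0.

Lemma tick_eq (x y : tick) :
  tick_edge x = tick_edge y -> tick_pos x = tick_pos y -> x = y.
Proof.
case: x y => [e k] [f l]; rewrite /tick_edge /tick_pos /= => ef.
by case: f / ef l => l kl; congr (existT _ _ _); apply: val_inj.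
Qed.

Lemma tick_at_edge x e k : k < absz (w e) -> tick_edge (tick_at x e k) = e.
Proof. by move=> ke; rewrite /tick_at insubT. Qed.

Lemma tick_at_pos x e k : k < absz (w e) -> tick_pos (tick_at x e k) = k.
Proof. by move=> ke; rewrite /tick_at insubT. Qed.

Lemma next_edgeP i e : 0 < absz (w e) ->
  exists j, [/\ next_edge i e = iter j.+1 (turn i) e,
    0 < absz (w (next_edge i e)) &
    forall k, k < j -> ~~ (0 < absz (w (iter k.+1 (turn i) e)))].
Proof.
move=> we; rewrite /next_edge; set s := traject _ _ _; pose p f := 0 < absz (w f); rewrite -/p.
have hs : has p s.
  have o0 : 0 < fingraph.order (turn i) e by apply: fingraph.order_gt0.
  apply/hasP; exists e => //; apply/trajectP.
  exists (fingraph.order (turn i) e).-1; first by rewrite prednK // max_card.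
  by rewrite -iterSr prednK // iter_order //; apply: turn_inj.
have lt : find p s < #|edge| by move: hs; rewrite has_find size_traject.
have nthE k : k < #|edge| -> nth e s k = iter k.+1 (turn i) e.
  by move=> kE; rewrite (set_nth_default (turn i e)) ?size_traject // nth_traject // iterSr.
exists (find p s); split; first exact: nthE.
  exact: (nth_find e hs).
move=> k kf; rewrite -nthE ?(ltn_trans kf) //.
by have := before_find e kf; rewrite /p => ->.
Qed.

Lemma iter_turn_inj i k : injective (iter k (turn i)).
Proof. by elim: k => [|k IHk] x y //= /turn_inj /IHk. Qed.

Lemma next_edge_inj i e f : 0 < absz (w e) -> 0 < absz (w f) ->
  next_edge i e = next_edge i f -> e = f.
Proof.
move=> we wf; have [j [-> _ Hj]] := next_edgeP i we.
have [k [-> _ Hk]] := next_edgeP i wf.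
wlog jk : e f j k we wf Hj Hk / j <= k.
  move=> H E; case/orP: (leq_total j k) => jk; first exact: H Hj Hk jk E.
  by apply/esym; apply: H Hk Hj jk (esym E).
rewrite -(subnK jk) -addnS addnC iterD => /iter_turn_inj.
case: (k - j) (leq_subr j k) => [//|l] lk E.
by have := Hk l lk; rewrite -E we.
Qed.

Lemma tick_edge_gt0 (x : tick) : 0 < absz (w (tick_edge x)).
Proof. exact: leq_ltn_trans (ltn_ord (tagged x)). Qed.

Lemma next_tick_inj i : injective (next_tick i).
Proof.
move=> x y; have gx := tick_edge_gt0 x; have gy := tick_edge_gt0 y.
have [_ [_ nx _]] := next_edgeP i gx; have [_ [_ ny _]] := next_edgeP i gy.
have lx : tick_pos x < absz (w (tick_edge x)) := ltn_ord (tagged x).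
have ly : tick_pos y < absz (w (tick_edge y)) := ltn_ord (tagged y).
rewrite /next_tick; case: ifP => hx; case: ifP => hy E;
  have Ee := congr1 tick_edge E; have Ep := congr1 tick_pos E;
  rewrite !tick_at_edge // in Ee; rewrite !tick_at_pos // in Ep.
  by apply: tick_eq => //; case: Ep.
have {}Ee := next_edge_inj gx gy Ee; apply: tick_eq => //.
have last_pos p W : p < W -> (p.+1 < W) = false -> p = W.-1.
  by case: W => // W pW /negbT; rewrite ltnS -ltnNge ltnS => Wp; apply/eqP; rewrite eqn_leq -ltnS pW.
by rewrite (last_pos _ _ lx hx) (last_pos _ _ ly hy) Ee.
Qed.

Definition sigma (i : nat) : {perm tick} := perm (@next_tick_inj i).

(* The transposition tau_{i+1}, with sigma_{i+1} = tau_{i+1} o sigma_i; the    *)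
(* product of permutations is read from left to right.                         *)
Definition tau (i : nat) : {perm tick} := ((sigma i)^-1 * sigma i.+1)%g.

(* A pair (i, c) with c a cycle of sigma_i given by its support.               *)
Definition stage : finType := ('I_r.+1 * {set tick})%type.

Definition stages : {set stage} := [set p : stage | p.2 \in porbits (sigma p.1)].

(* (i, c) ~ (i+1, c) when sigma_i and sigma_{i+1} have the same cycle c.       *)
Definition same_cycle (p q : stage) : bool :=
  [&& p \in stages, q \in stages, (q.1 : nat) == p.1.+1, q.2 == p.2 &
      [forall x in p.2, sigma p.1 x == sigma q.1 x]].

Definition stage_equiv : rel stage :=
  connect (fun p q => same_cycle p q || same_cycle q p).

Definition strand : finType :=
  {A : {set stage} | A \in equivalence_partition stage_equiv stages}.

Definition white_cycle (k : 'I_m) : {set tick} :=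
  [set x | in_white_face k (tick_edge x)].
Definition gray_cycle (k : 'I_n) : {set tick} :=
  [set x | in_gray_face k (tick_edge x)].

(* The cycle c of sigma_i or sigma_{i+1} is joined or cut by tau_{i+1}, or     *)
(* results from this operation.                                                *)
Definition affected (i : nat) (c : {set tick}) : bool :=
  [exists x in c, tau i x != x].

End Ticks.

End RibbonGraphs.

(* Vertices are determined by their labels: those of a graph with m sources,   *)
(* n sinks and r inner vertices are identified with their labels.              *)
Definition tvertex (m n r : nat) : finType := ('I_m + 'I_n + 'I_r)%type.

Definition source {m n r} (i : 'I_m) : tvertex m n r := inl (inl i).
Definition sink {m n r} (j : 'I_n) : tvertex m n r := inl (inr j).
Definition inner {m n r} (k : 'I_r) : tvertex m n r := inr k.

(* A directed multigraph is given by the incidence relations "a starts at v"   *)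
(* and "a ends at v" between edges and vertices.  That every edge has exactly  *)
(* one start and one end is the condition is_digraph, so that it is part of    *)
(* what is claimed about the tropicalization.                                  *)
Record tgraph (m n r : nat) := TGraph {
  tedge : finType;
  starts : tedge -> tvertex m n r -> bool;
  ends : tedge -> tvertex m n r -> bool
}.

Section TGraphs.

Variables m n r : nat.
Implicit Types X Y : tgraph m n r.

Definition tweighting X := {ffun tedge X -> int^o}.

Definition is_digraph X : Prop :=
  forall a : tedge X, #|[set v | starts a v]| = 1 /\ #|[set v | ends a v]| = 1.

Definition outdeg X (v : tvertex m n r) := #|[set a : tedge X | starts a v]|.
Definition indeg X (v : tvertex m n r) := #|[set a : tedge X | ends a v]|.

Definition is_tropical X : Prop :=
  [/\ is_digraph X,
      forall i, outdeg X (source i) = 1 /\ indeg X (source i) = 0,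
      forall j, outdeg X (sink j) = 0 /\ indeg X (sink j) = 1,
      forall k, indeg X (inner k) + outdeg X (inner k) = 3 &
      forall (a : tedge X) i j, starts a (inner i) -> ends a (inner j) -> i < j].

Definition is_monodromy (mu : m.-tuple nat) (nu : n.-tuple nat) (g : nat)
    X (wt : tweighting X) : Prop :=
  [/\ is_tropical X /\ r + 2 = 2 * g + m + n,
      forall a, (0 <= wt a :> int)%R,
      forall a i, starts a (source i) -> (wt a = (tnth mu i)%:Z)%R,
      forall a j, ends a (sink j) -> (wt a = (tnth nu j)%:Z)%R &
      forall k, (\sum_(a | ends a (inner k)) wt a
                   = \sum_(a | starts a (inner k)) wt a)%R].

Definition isomorphic_weighted X (wt : tweighting X) Y (wt' : tweighting Y) : Prop :=
  exists f : tedge X -> tedge Y,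
    [/\ bijective f,
        forall a v, starts (f a) v = starts a v,
        forall a v, ends (f a) v = ends a v &
        forall a, wt' (f a) = wt a].

Variables (G : mnr_ribbon_graph m n r) (w : weighting G).

Definition strand_starts (s : strand w) (v : tvertex m n r) : bool :=
  match v with
  | inl (inl k) =>
      [exists p in val s, ((p.1 : nat) == 0) && (p.2 == white_cycle w k)]
  | inl (inr _) => false
  | inr i =>
      [exists p in val s, ((p.1 : nat) == i.+1) && affected i p.2]
  end.

Definition strand_ends (s : strand w) (v : tvertex m n r) : bool :=
  match v with
  | inl (inl _) => false
  | inl (inr k) =>
      [exists p in val s, ((p.1 : nat) == r) && (p.2 == gray_cycle w k)]
  | inr i =>
      [exists p in val s, ((p.1 : nat) == i) && affected i p.2]
  end.

Definition tropicalization : tgraph m n r :=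
  TGraph strand_starts strand_ends.

(* All the pairs in a class have the same cycle; any of them gives the length. *)
Definition strand_length (s : strand w) : nat :=
  if [pick p in val s] is Some p then #|p.2| else 0.

Definition tropical_weight : tweighting tropicalization :=
  [ffun s : tedge tropicalization => (strand_length s)%:Z%R : int^o].

End TGraphs.

Definition is_partition (k d : nat) (mu : k.-tuple nat) : Prop :=
  [/\ sorted geq mu, all (leq 1) mu & sumn mu = d].

(* Main.v *)
Require Import Defs.
From HB Require Import structures.
From mathcomp Require Import all_boot all_order all_fingroup all_algebra.
From mathcomp Require Import zify.

Set Implicit Arguments.
Unset Strict Implicit.
Unset Printing Implicit Defensive.

Import Order.TTheory GRing.Theory Num.Theory.

Local Open Scope nat_scope.

(* Forgetting the tick marks, the turning rule of stage i is itself a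
   permutation of the edges, and passing from stage i to stage i + 1 exchanges
   the two edges that leave a vertex, so that it joins or cuts orbits. The graph
   of these joins and cuts is the tropical graph; it depends only on the ribbon
   graph.  An edge of weight 0 goes from a smaller to a larger vertex label, so
   no closed walk has weight 0 and no walk of weight 0 returns to a vertex.
   Hence every orbit of edges carries tick marks, which form a single cycle, and
   this cycle is joined or cut exactly when the orbit is: the tropicalization of
   every positive weighting is the same graph, and the weight of a cycle is the
   sum of the weights of the edges of its orbit. *)

(** * Orbits of permutations that differ by a transposition *)

Section Orbits.

Variable X : finType.
Implicit Types s t : {perm X}.

Lemma porbits_eq s C D x :
  C \in porbits s -> D \in porbits s -> x \in C -> x \in D -> C = D.
Proof.
case/imsetP=> y _ -> /imsetP[z _ ->].
by rewrite -!eq_porbit_mem => /eqP <- /eqP <-.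
Qed.

Lemma partition_porbits s : partition (porbits s) setT.
Proof.
apply/and3P; split.
- rewrite eqEsubset subsetT; apply/subsetP=> x _; apply/bigcupP.
  by exists (porbit s x); rewrite ?imset_f ?porbit_id.
- apply/trivIsetP=> C D Cs Ds; apply: contraNT => /pred0Pn[x /andP[xC xD]].
  exact/eqP/(porbits_eq Cs Ds xC xD).
by apply/imsetP=> -[x _ /setP/(_ x)]; rewrite porbit_id inE.
Qed.

Lemma porbits_stable s C x : C \in porbits s -> (s x \in C) = (x \in C).
Proof.
case/imsetP=> y _ ->; rewrite -!eq_porbit_mem.
by have /= -> := porbit_perm s 1 x.
Qed.

(** Choosing one point per label matches labels with orbits. This counts vertices and faces in the
    Euler relation. *)
Lemma card_porbits_label (L : finType) (lab : X -> L) s :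
    (forall x y, (lab x == lab y) = (y \in porbit s x)) ->
    (forall k, exists x, lab x = k) ->
  #|porbits s| = #|L|.
Proof.
move=> labP lab_onto; have /fin_all_exists[h hK] := lab_onto.
have h_inj : injective (fun k => porbit s (h k)).
  move=> k l /= hkl; apply/eqP.
  by rewrite -(hK k) -(hK l) labP hkl porbit_id.
rewrite -(card_imset predT h_inj); apply: eq_card => C.
apply/imsetP/imsetP=> -[x _ ->]; last by exists (h x).
by exists (lab x) => //; apply/eqP; rewrite eq_porbit_mem -labP hK.
Qed.

Lemma card_uniform_porbits s k : (forall x, #|porbit s x| = k) ->
  #|X| = #|porbits s| * k.
Proof.
move=> sk; rewrite -cardsT.
apply: card_uniform_partition (partition_porbits s) => _ /imsetP[x _ ->].
exact: sk.
Qed.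

Lemma porbit_eq_on s t x : {in porbit s x, s =1 t} -> porbit t x = porbit s x.
Proof.
move=> st; have E i : (t ^+ i)%g x = (s ^+ i)%g x.
  elim: i => [|i IHi]; first by rewrite !expg0.
  by rewrite !expgSr !permM IHi -st ?mem_porbit.
apply/setP=> y; apply/porbitP/porbitP=> -[i ->]; exists i; by rewrite E.
Qed.

Lemma porbits_eq_on s t C : C \in porbits s -> {in C, s =1 t} ->
  C \in porbits t.
Proof. by case/imsetP=> x _ -> /porbit_eq_on <-; apply: imset_f. Qed.

(** Applied to the quotient of two consecutive permutations, this singles out the orbits joined or
    cut. The body is that of [affected], so the lemmas below also serve for cycles of tick marks. *)
Definition moves (t : {perm X}) (C : {set X}) : bool := [exists x in C, t x != x].

Lemma moves_tperm x y C : x != y -> moves (tperm x y) C = (x \in C) || (y \in C).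
Proof.
move=> xy; apply/exists_inP/orP=> [[z zC]|[xC|yC]].
- by case: (tpermP x y z) => [zx|zy|]; rewrite ?eqxx // -?zx -?zy zC; [left|right].
- by exists x; rewrite // tpermL eq_sym.
- by exists y; rewrite // tpermR.
Qed.

(** * Orbits moved by the quotient of two permutations *)

Section JoinOrCut.

Variables s t : {perm X}.
Implicit Type C : {set X}.

(** The quotient sends [s z] to [t z], so it fixes [s z] exactly when [s] and [t] agree at [z]. *)
Lemma moves_eq_on C : C \in porbits s -> ~~ moves (s^-1 * t)%g C ->
  {in C, s =1 t}.
Proof.
move=> Cs /exists_inPn C0 z zC; apply/esym.
have := C0 (s z); rewrite porbits_stable // => /(_ zC).
by rewrite negbK permM permK => /eqP.
Qed.

Lemma eq_on_moves C : C \in porbits s -> {in C, s =1 t} ->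
  ~~ moves (s^-1 * t)%g C.
Proof.
move=> Cs st; apply/exists_inPn=> z zC; rewrite negbK permM -st ?permKV //.
by rewrite -(porbits_stable _ Cs) permKV.
Qed.

Lemma moves_eq_on' C : C \in porbits t -> ~~ moves (s^-1 * t)%g C ->
  {in C, t =1 s}.
Proof.
move=> Ct /exists_inPn C0 z zC; have := C0 (t z).
rewrite porbits_stable // => /(_ zC); rewrite negbK permM => /eqP/perm_inj tz.
by rewrite -{2}tz permKV.
Qed.

Lemma unmoved_porbits C : ~~ moves (s^-1 * t)%g C ->
  (C \in porbits s) = (C \in porbits t).
Proof.
move=> C0; apply/idP/idP=> Cp; apply: porbits_eq_on (Cp) _.
  exact: moves_eq_on.
exact: moves_eq_on'.
Qed.

(** The orbits of [s] and those of [t] both partition the whole set, so the total sums agree; the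
    unmoved orbits are common to both and cancel. This becomes the balance of weights at a trivalent
    vertex. *)
Lemma sum_moved (R : zmodType) (f : X -> R) :
  (\sum_(C in porbits s | moves (s^-1 * t)%g C) \sum_(x in C) f x
   = \sum_(C in porbits t | moves (s^-1 * t)%g C) \sum_(x in C) f x)%R.
Proof.
have tot u : (\sum_(C in porbits u) \sum_(x in C) f x = \sum_x f x)%R.
  rewrite -(set_partition_big _ (partition_porbits u)).
  by apply: eq_bigl => x; rewrite inE.
have := tot s; rewrite -(tot t) (bigID (moves (s^-1 * t)%g)) /=.
rewrite [RHS](bigID (moves (s^-1 * t)%g)) /=.
set a := (X in (_ + X = _)%R); set b := (X in (_ = _ + X)%R -> _).
suff -> : a = b by move/addIr.
apply: eq_bigl => C /=; case: (boolP (moves _ C)) => [|/unmoved_porbits->] //.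
by rewrite !andbF.
Qed.

Variables x y : X.
Hypotheses (xy : x != y) (def_t : t = (s * tperm x y)%g).

Let Dt : (s^-1 * t)%g = tperm x y. Proof. by rewrite def_t mulKg. Qed.

(** The moved orbits are those of [x] and of [y], which may coincide. *)
Lemma card_moved_porbits u :
  #|[set C in porbits u | moves (tperm x y) C]| = (x \notin porbit u y).+1.
Proof.
rewrite (_ : [set C in _ | _] = [set porbit u x; porbit u y]).
  by rewrite cards2 eq_porbit_mem.
apply/setP=> C; rewrite !inE moves_tperm //; apply/andP/orP.
  case=> Cu /orP[xC|yC]; [left|right].
    by rewrite (porbits_eq Cu (imset_f _ _) xC (porbit_id u x)).
  by rewrite (porbits_eq Cu (imset_f _ _) yC (porbit_id u y)).
by case=> /eqP->; rewrite imset_f ?porbit_id ?orbT.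
Qed.

(* By porbits_mul_tperm, exactly one of s and t has x and y in the same orbit. *)
Lemma card_moved :
  #|[set C in porbits s | moves (s^-1 * t)%g C]|
    + #|[set C in porbits t | moves (s^-1 * t)%g C]| = 3.
Proof.
rewrite Dt !card_moved_porbits.
(* [porbits_mul_tperm] has the transposition on the left; passing to inverses keeps the orbits and
   moves it to the right. *)
have N u : #|porbits (u * tperm x y)%g| + (x \notin porbit u y).*2
    = #|porbits u| + 1.
  rewrite -(porbitsV (_ * _)%g) -(porbitsV u) -porbitV invMg tpermV.
  by have := porbits_mul_tperm u^-1%g x y; rewrite /= xy.
have := N s; have := N t; rewrite {1}def_t -mulgA tperm2 mulg1 -def_t; lia.
Qed.

End JoinOrCut.

End Orbits.

(** * The tropical graph of a sequence of permutations *)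

Section PermGraph.

Variables (X : finType) (m n r : nat) (s : nat -> {perm X}).
Variables (white : 'I_m -> {set X}) (gray : 'I_n -> {set X}).

Definition touches i : pred {set X} := moves ((s i)^-1 * s i.+1)%g.

Definition level : finType := ('I_r.+1 * {set X})%type.

Definition level_orbits : {set level} :=
  [set p : level | p.2 \in porbits (s p.1)].

(** A closed form of the relation generated by unchanged cycles at consecutive levels: the orbit
    survives every transition between the two levels. [stage_equivE] relates it to the generated
    relation. *)
Definition persist (p q : level) : bool :=
  (p.2 == q.2) &&
  [forall j : 'I_r, (minn p.1 q.1 <= j < maxn p.1 q.1) ==> ~~ touches j p.2].

Definition perm_strand : finType :=
  {A : {set level} | A \in equivalence_partition persist level_orbits}.

(** All members of a strand carry the same orbit; the union recovers it without choosing a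
    representative. *)
Definition strand_orbit (a : perm_strand) : {set X} := \bigcup_(p in val a) p.2.

Definition perm_starts (a : perm_strand) (v : tvertex m n r) : bool :=
  match v with
  | inl (inl k) => [exists p in val a, ((p.1 : nat) == 0) && (p.2 == white k)]
  | inl (inr _) => false
  | inr i => [exists p in val a, ((p.1 : nat) == i.+1) && touches i p.2]
  end.

Definition perm_ends (a : perm_strand) (v : tvertex m n r) : bool :=
  match v with
  | inl (inl _) => false
  | inl (inr k) => [exists p in val a, ((p.1 : nat) == r) && (p.2 == gray k)]
  | inr i => [exists p in val a, ((p.1 : nat) == i) && touches i p.2]
  end.

Definition perm_graph : tgraph m n r := TGraph perm_starts perm_ends.

Implicit Types p q : level.

Lemma persistP p q :
  reflect (p.2 = q.2 /\
           forall j : 'I_r, minn p.1 q.1 <= j < maxn p.1 q.1 -> ~~ touches j p.2)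
          (persist p q).
Proof.
apply: (iffP andP) => -[E H]; split; try exact/eqP.
  by move=> j; apply/implyP/(forallP H).
by apply/forallP=> j; apply/implyP/H.
Qed.

Lemma persist_refl : reflexive persist.
Proof. by move=> p; apply/persistP; split=> // j; lia. Qed.

Lemma persist_sym : symmetric persist.
Proof.
by move=> p q; apply/persistP/persistP=> -[E H]; split=> // j;
  rewrite -E 1?minnC 1?maxnC; apply: H.
Qed.

(** Every transition between the outer two levels lies between the middle level and one of them. *)
Lemma persist_trans : transitive persist.
Proof.
move=> q p u /persistP[Epq Hpq] /persistP[Equ Hqu]; apply/persistP.
split=> [|j jpu]; first by rewrite Epq.
have [|jpq] := boolP (minn p.1 q.1 <= j < maxn p.1 q.1); first exact: Hpq.
by rewrite Epq Hqu //; lia.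
Qed.

Lemma perm_strandP (a : perm_strand) : exists2 p,
  p \in level_orbits & val a = [set q in level_orbits | persist p q].
Proof. exact/imsetP/(valP a). Qed.

Fact strand_of_subproof p : p \in level_orbits ->
  [set q in level_orbits | persist p q]
    \in equivalence_partition persist level_orbits.
Proof. exact: imset_f. Qed.

Definition strand_of p (pL : p \in level_orbits) : perm_strand :=
  Sub [set q in level_orbits | persist p q] (strand_of_subproof pL).

Lemma mem_strand_of p (pL : p \in level_orbits) : p \in val (strand_of pL).
Proof. by rewrite inE pL persist_refl. Qed.

Lemma strand_level (a : perm_strand) p : p \in val a -> p \in level_orbits.
Proof. by case: (perm_strandP a) => p0 _ ->; rewrite inE => /andP[]. Qed.

Lemma strand_mem (a : perm_strand) p q : p \in val a ->
  (q \in val a) = (q \in level_orbits) && persist p q.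
Proof.
case: (perm_strandP a) => p0 _ ->; rewrite !inE => /andP[_ p0p].
congr (_ && _); apply/idP/idP; apply: persist_trans => //.
by rewrite persist_sym.
Qed.

Lemma strand_persist (a : perm_strand) p q :
  p \in val a -> q \in val a -> persist p q.
Proof. by move=> pa; rewrite (strand_mem _ pa) => /andP[]. Qed.

Lemma strand_eq (a b : perm_strand) p : p \in val a -> p \in val b -> a = b.
Proof.
by move=> pa pb; apply/val_inj/setP=> q; rewrite !(strand_mem _ pa, strand_mem _ pb).
Qed.

Lemma strand_orbitE (a : perm_strand) p : p \in val a -> strand_orbit a = p.2.
Proof.
move=> pa; apply/setP=> x; apply/bigcupP/idP=> [[q qa]|]; last by exists p.
by case/persistP: (strand_persist pa qa) => ->.
Qed.

Lemma strand_neq0 (a : perm_strand) : exists p, p \in val a.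
Proof.
by case: (perm_strandP a) => p pL ->; exists p; rewrite inE pL persist_refl.
Qed.

(** * Strands through a fixed level *)

Section AtLevel.

Variables (i : nat) (Q : pred {set X}).
Hypothesis ir : i <= r.

Let B := [set a : perm_strand | [exists p in val a, ((p.1 : nat) == i) && Q p.2]].

(** A strand that meets level [i] is the class of [(i, C)], where [C] is its orbit. Counts and sums
    over such strands thus become counts and sums over orbits of [s i]. *)
Lemma strand_orbit_inj : {in B &, injective strand_orbit}.
Proof.
move=> a b; rewrite !inE => /exists_inP[[j C] pa /= /andP[/eqP ji _]].
case/exists_inP=> [[k D] qb /= /andP[/eqP ki _]].
rewrite (strand_orbitE pa) (strand_orbitE qb) /= => E.
suff E' : (j, C) = (k, D) by apply: strand_eq pa _; rewrite E'.
by rewrite E; congr (_, _); apply: val_inj; rewrite /= ji ki.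
Qed.

Lemma strand_orbit_image :
  strand_orbit @: B = [set C in porbits (s i) | Q C].
Proof.
apply/setP=> C; apply/imsetP/idP=> [[a + ->]|].
  rewrite !inE => /exists_inP[p pa /andP[/eqP pi Qp]].
  by have := strand_level pa; rewrite (strand_orbitE pa) !inE pi Qp andbT.
rewrite inE => /andP[Cs QC].
have CL : (inord i, C) \in level_orbits by rewrite inE /= inordK.
exists (strand_of CL); last by rewrite (strand_orbitE (mem_strand_of CL)).
rewrite inE; apply/existsP; exists (inord i, C).
by rewrite mem_strand_of /= inordK ?eqxx.
Qed.

Lemma card_strands : #|B| = #|[set C in porbits (s i) | Q C]|.
Proof. by rewrite -strand_orbit_image card_in_imset //; apply: strand_orbit_inj. Qed.

Lemma sum_strands (R : nmodType) (F : {set X} -> R) :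
  (\sum_(a in B) F (strand_orbit a) = \sum_(C in porbits (s i) | Q C) F C)%R.
Proof.
rewrite -(big_imset F strand_orbit_inj) strand_orbit_image.
by apply: eq_bigl => C; rewrite inE.
Qed.

End AtLevel.

Hypothesis s_tperm : forall i : 'I_r, exists x y,
  x != y /\ s i.+1 = (s i * tperm x y)%g.
Hypotheses (white_inj : injective white) (gray_inj : injective gray).
Hypothesis whiteE : porbits (s 0) = [set white k | k : 'I_m].
Hypothesis grayE : porbits (s r) = [set gray k | k : 'I_n].

Lemma persist_next (i j : 'I_r.+1) (C : {set X}) : j = i.+1 :> nat ->
  ~~ touches i C ->
  ((i, C) \in level_orbits) = ((j, C) \in level_orbits) /\ persist (i, C) (j, C).
Proof.
move=> ji iC; split; first by rewrite !inE /= ji; apply: unmoved_porbits.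
apply/persistP; split=> //= k; rewrite ji => H.
by have -> : nat_of_ord k = i by lia.
Qed.

(** Consider the lowest level of the strand. At level 0 the orbit is a white face; otherwise the
    transition just below touches the orbit, or else the strand would extend one level lower. *)
Lemma perm_start_exists (a : perm_strand) : exists v, perm_starts a v.
Proof.
have [p0 p0a] := strand_neq0 a.
case: (arg_minnP (fun p : 'I_r.+1 * {set X} => p.1 : nat) p0a) => p pa pmin.
case Ep: (p.1 : nat) => [|i].
  have := strand_level pa; rewrite inE Ep whiteE => /imsetP[k _ pk].
  by exists (source k); apply/exists_inP; exists p; rewrite // Ep pk !eqxx.
have ir : i < r by have := ltn_ord p.1; lia.
exists (inner (Ordinal ir)); apply/exists_inP; exists p => //=.
rewrite Ep eqxx /=; apply: contraT => pi.
have iK : inord i = i :> nat := @inordK r i (ltnW ir).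
have [||L P] := @persist_next (inord i) p.1 p.2; rewrite ?iK //.
have : (inord i, p.2) \in val a.
  rewrite (strand_mem _ pa) L persist_sym.
  by move: (strand_level pa) P; case: (p) => ? ? /= -> ->.
by move/pmin; rewrite /= iK Ep ltnn.
Qed.

(** Dual argument at the highest level of the strand. *)
Lemma perm_end_exists (a : perm_strand) : exists v, perm_ends a v.
Proof.
have [p0 p0a] := strand_neq0 a.
case: (arg_maxnP (fun p : 'I_r.+1 * {set X} => p.1 : nat) p0a) => p pa pmax.
have [Ep|pr] := eqVneq (p.1 : nat) r.
  have := strand_level pa; rewrite inE Ep grayE => /imsetP[k _ pk].
  by exists (sink k); apply/exists_inP; exists p; rewrite // Ep pk !eqxx.
have ir : p.1 < r by have := ltn_ord p.1; lia.
exists (inner (Ordinal ir)); apply/exists_inP; exists p => //=.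
rewrite eqxx /=; apply: contraT => pi.
have [|L P] := @persist_next p.1 (inord p.1.+1) p.2 _ pi; rewrite ?inordK //.
have : (inord p.1.+1, p.2) \in val a.
  rewrite (strand_mem _ pa) -L.
  by move: (strand_level pa) P; case: (p) => ? ? /= -> ->.
by move/pmax; rewrite /= inordK // ltnn.
Qed.

Lemma strand_touch (a : perm_strand) p q (j : 'I_r) : p \in val a -> q \in val a ->
  minn p.1 q.1 <= j < maxn p.1 q.1 -> ~~ touches j p.2 /\ ~~ touches j q.2.
Proof. by move=> pa qa H; case/persistP: (strand_persist pa qa) => <- /(_ j H). Qed.

Lemma perm_start_unique (a : perm_strand) u v :
  perm_starts a u -> perm_starts a v -> u = v.
Proof.
(* Order the possible starts by level: source first, then inner vertices by increasing label. The
   transition of a later start [v] would then lie strictly inside the strand, which must not be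
   touched there. *)
wlog: u v / if v is inr j then
  if u is inr i then (i <= j)%N else true else if u is inr i then false else true.
  move=> H; case: u v => [[k|k]|i] [[l|l]|j] //= pu pv; try by [apply: H|apply/esym/H].
  by case/orP: (leq_total i j) => ij; [apply: H|apply/esym/H].
case: v => [[l|l]|j] // Huv; case: u Huv => [[k|k]|i] //= Huv.
- move=> /exists_inP[p pa /andP[_ /eqP pk]] /exists_inP[q qa /andP[_ /eqP ql]].
  congr (inl (inl _)); apply: white_inj; rewrite -pk -ql.
  by rewrite -(strand_orbitE pa) -(strand_orbitE qa).
- move=> /exists_inP[p pa /andP[/eqP pi _]] /exists_inP[q qa /andP[/eqP qj tq]].
  by have [] := strand_touch (j := j) pa qa; [rewrite pi qj; lia|rewrite tq].
- move=> /exists_inP[p pa /andP[/eqP pi _]] /exists_inP[q qa /andP[/eqP qj tq]].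
  have [ij|ij] := eqVneq (i : nat) j; first by rewrite (val_inj ij).
  by have [] := strand_touch (j := j) pa qa; [rewrite pi qj; lia|rewrite tq].
Qed.

Lemma perm_end_unique (a : perm_strand) u v :
  perm_ends a u -> perm_ends a v -> u = v.
Proof.
(* Now from the top downwards: sink first, then inner vertices by decreasing label. *)
wlog: u v / if v is inr j then
  if u is inr i then (j <= i)%N else true else if u is inr i then false else true.
  move=> H; case: u v => [[k|k]|i] [[l|l]|j] //= pu pv; try by [apply: H|apply/esym/H].
  by case/orP: (leq_total j i) => ij; [apply: H|apply/esym/H].
case: v => [[l|l]|j] // Huv; case: u Huv => [[k|k]|i] //= Huv.
- move=> /exists_inP[p pa /andP[_ /eqP pk]] /exists_inP[q qa /andP[_ /eqP ql]].
  congr (inl (inr _)); apply: gray_inj; rewrite -pk -ql.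
  by rewrite -(strand_orbitE pa) -(strand_orbitE qa).
- move=> /exists_inP[p pa /andP[/eqP pi _]] /exists_inP[q qa /andP[/eqP qj tq]].
  have [] := strand_touch (j := j) pa qa; last by rewrite tq.
  by rewrite pi qj; have := ltn_ord j; lia.
- move=> /exists_inP[p pa /andP[/eqP pi _]] /exists_inP[q qa /andP[/eqP qj tq]].
  have [ij|ij] := eqVneq (i : nat) j; first by rewrite (val_inj ij).
  by have [] := strand_touch (j := j) pa qa; [rewrite pi qj; lia|rewrite tq].
Qed.

Lemma perm_graph_tropical : is_tropical perm_graph.
Proof.
split.
- have one (P : tvertex m n r -> bool) :
    (exists v, P v) -> (forall u v, P u -> P v -> u = v) -> #|[set v | P v]| = 1.
    move=> [v Pv] uniqP; apply/eqP/cards1P; exists v; apply/setP=> u.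
    rewrite !inE; apply/idP/eqP=> [Pu|-> //]; exact: uniqP.
  move=> a; split; apply: one.
  + exact: perm_start_exists.
  + exact: perm_start_unique.
  + exact: perm_end_exists.
  + exact: perm_end_unique.
- move=> k; split; last by apply: eq_card0 => a; rewrite inE.
  rewrite /outdeg /= (card_strands (pred1 (white k)) (leq0n r)) whiteE.
  apply/eqP/cards1P; exists (white k); apply/setP=> C; rewrite !inE.
  by apply: andb_idl => /eqP->; apply: imset_f.
- move=> k; split; first by apply: eq_card0 => a; rewrite inE.
  rewrite /indeg /= (card_strands (pred1 (gray k)) (leqnn r)) grayE.
  apply/eqP/cards1P; exists (gray k); apply/setP=> C; rewrite !inE.
  by apply: andb_idl => /eqP->; apply: imset_f.
(* The edges at vertex [k] are the moved orbits on the two sides of the transition. *)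
- move=> k; rewrite /indeg /outdeg /= !(card_strands (touches k)) //; last exact: ltnW.
  by have [x [y [xy sk]]] := s_tperm k; apply: card_moved xy sk.
(* A start at [i] sits at level [i.+1] and an end at [j] at level [j]. If [j <= i], the transition
   [i] that touches the orbit would lie between these levels. *)
move=> a i j /exists_inP[p pa /andP[/eqP pi tp]].
case/exists_inP=> [q qa /andP[/eqP qj _]]; rewrite ltnNge; apply/negP=> ji.
by have [] := strand_touch (j := i) pa qa; [rewrite pi qj; lia|rewrite tp].
Qed.

Variable f : X -> int.

Definition strand_weight : tweighting perm_graph :=
  [ffun a : tedge perm_graph => \sum_(x in strand_orbit a) f x : int^o]%R.

Lemma perm_graph_monodromy (mu : m.-tuple nat) (nu : n.-tuple nat) g :
    r + 2 = 2 * g + m + n -> (forall x, 0 <= f x)%R ->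
    (forall k, \sum_(x in white k) f x = (tnth mu k)%:Z)%R ->
    (forall k, \sum_(x in gray k) f x = (tnth nu k)%:Z)%R ->
  is_monodromy mu nu g strand_weight.
Proof.
move=> Eg f0 fmu fnu; split.
- by split=> //; apply: perm_graph_tropical.
- by move=> a; rewrite ffunE; apply: sumr_ge0.
- by move=> a k /exists_inP[p pa /andP[_ /eqP pk]]; rewrite ffunE (strand_orbitE pa) pk.
- by move=> a k /exists_inP[p pa /andP[_ /eqP pk]]; rewrite ffunE (strand_orbitE pa) pk.
(* Both sides become sums over the moved orbits of a single level, which [sum_moved] compares. *)
move=> k; pose F (C : {set X}) : int^o := (\sum_(x in C) f x)%R.
have E (B : pred perm_strand) :
    (\sum_(a | B a) strand_weight a = \sum_(a in [set a | B a]) F (strand_orbit a))%R.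
  by apply: eq_big => a; rewrite ?inE // ffunE.
rewrite !E /= !(sum_strands (touches k)) //; last exact: ltnW.
exact: sum_moved.
Qed.

End PermGraph.

(** * Turns and tick marks *)

Section Turns.

Variables (m n r : nat) (G : mnr_ribbon_graph m n r).
Implicit Types e f : edge G.

Definition turn_perm i : {perm edge G} := perm (@turn_inj m n r G i).

Lemma turn_permE i e : turn_perm i e = turn i e.
Proof. exact: permE. Qed.

Lemma turn_permX i k e : (turn_perm i ^+ k)%g e = iter k (turn i) e.
Proof. by rewrite permX; apply: eq_iter; apply: turn_permE. Qed.

(** The dart [drev G (vrot G x)] is followed along its face by [x], and reversing a dart changes the
    color. *)
Lemma is_inl_vrot (x : dart G) : is_inl (flabel (vrot G x)) = ~~ is_inl (flabel x).
Proof.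
have := flabel_fnext (drev G (vrot G x)).
rewrite permM drev_involutive permK => ->.
by rewrite bicolored negbK.
Qed.

Lemma vrot4 (x : dart G) : vrot G (vrot G (vrot G (vrot G x))) = x.
Proof. by have := iter_porbit (vrot G) x; rewrite four_valent. Qed.

Lemma vrot2_neq (x : dart G) : vrot G (vrot G x) != x.
Proof.
have := uniq_traject_porbit (vrot G) x; rewrite four_valent /= !inE.
by rewrite !negb_or -!andbA => /and3P[_ x2 _]; rewrite eq_sym.
Qed.

(** Colors alternate among the four darts at a vertex, so only opposite darts share a color. *)
Lemma vlabel_vrot2 (x y : dart G) : vlabel x = vlabel y ->
  is_inl (flabel x) = is_inl (flabel y) -> (y == x) || (y == vrot G (vrot G x)).
Proof.
move=> /eqP; rewrite vlabelP porbit_traject four_valent /= !inE.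
by case/or4P=> /eqP->; rewrite ?eqxx ?orbT // !is_inl_vrot; case: is_inl.
Qed.

(** The two naturally oriented edges leaving a vertex are opposite darts. At vertex [k], stage [k]
    turns left and stage [k.+1] turns right, which exchanges these two edges. *)
Lemma out_edges (k : 'I_r) : exists a b : edge G,
  [/\ a != b, forall e, (tail_label e == k) = (e == a) || (e == b) &
      forall e, turn k.+1 e = tperm a b (turn k e)].
Proof.
have [x [xk wx]] : exists x : dart G, vlabel x = k /\ is_inl (flabel x).
  have [x xk] := vlabel_onto G k; have [wx|wx] := boolP (is_inl (flabel x)).
    by exists x.
  by exists (vrot G x); rewrite vlabel_vrot is_inl_vrot.
have wx2 : is_inl (flabel (vrot G (vrot G x))) by rewrite !is_inl_vrot wx.
pose a : edge G := exist _ x wx; pose b : edge G := exist _ (vrot G (vrot G x)) wx2.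
have tail_ab e : (tail_label e == k) = (e == a) || (e == b).
  apply/eqP/orP=> [ek|[]/eqP->]; rewrite /tail_label /= ?vlabel_vrot //.
  by apply/orP/vlabel_vrot2; rewrite ?xk ?wx ?(valP e).
have ab : a != b by rewrite -val_eqE eq_sym vrot2_neq.
(* Away from vertex [k] both stages turn alike, onto an edge that the transposition fixes. *)
exists a, b; split=> // e; have [ke|ke] := eqVneq (head_label e) k; last first.
  have -> : turn k.+1 e = turn k e.
    rewrite /turn; have [kh|kh] := ltnP k (head_label e).+1; rewrite ltnS.
      by rewrite ltn_neqAle eq_sym ke -ltnS kh.
    by rewrite ltnNge (ltnW kh).
  have := tail_ab (turn k e); rewrite tail_turn (negbTE ke) => /esym/norP[ea eb].
  by rewrite tpermD // eq_sym.
have -> : turn k.+1 e = turn_right e by rewrite /turn ke ltnn.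
have te : turn k e = turn_left e by rewrite /turn ke ltnSn.
(* The two turns are the neighbors of the incoming dart on either side, hence two rotations
   apart. *)
have v2 : val (turn_right e) = vrot G (vrot G (val (turn_left e))).
  by rewrite /= permKV.
apply: val_inj; rewrite v2 -te; have := tail_ab (turn k e).
rewrite tail_turn ke eqxx => /esym/orP[]/eqP->; first by rewrite tpermL.
by rewrite tpermR /= vrot4.
Qed.

(** * Walks through edges without tick marks *)

Section Ticks.

Variable w : weighting G.

Definition positive_on e : bool := 0 < absz (w e).

Definition ticks (C : {set edge G}) : {set tick w} := [set x | tick_edge x \in C].

(* e must have weight 0 unless the path is empty; f may have any weight. *)
Inductive zero_path i : edge G -> edge G -> Prop :=
| ZeroPath0 e : zero_path i e e
| ZeroPathS e f : zero_path i e f -> ~~ positive_on f -> zero_path i e (turn i f).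

Lemma zero_path_trans i e f h :
  zero_path i e f -> zero_path i f h -> zero_path i e h.
Proof.
move=> ef fh; elim: fh e ef => [//|{}f {}h _ IH h0] e ef.
exact: ZeroPathS (IH _ ef) h0.
Qed.

Lemma zero_path_inv i e f : zero_path i e f ->
  e = f \/ ~~ positive_on e /\ zero_path i (turn i e) f.
Proof.
elim=> {e f} [e|e f _ IH f0]; first by left.
case: IH => [->|[e0 ef]]; right; split=> //; first exact: ZeroPath0.
exact: ZeroPathS ef f0.
Qed.

Lemma zero_path_last i e f : zero_path i e f ->
  e = f \/ exists h, [/\ zero_path i e h, ~~ positive_on h & f = turn i h].
Proof. by case=> {e f} [e|e h eh h0]; [left|right; exists h]. Qed.

(** Walks are deterministic, so of two walks from one edge, one prolongs the other. *)
Lemma zero_path_forward i e f h : zero_path i e f -> zero_path i e h ->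
  zero_path i f h \/ zero_path i h f.
Proof.
elim=> [{}e|{}e {}f _ IH f0] eh; first by left.
case: (IH eh) => [fh|hf]; last by right; apply: ZeroPathS.
case: (zero_path_inv fh) => [fh'|[_ fh']]; last by left.
by right; rewrite -fh'; apply: ZeroPathS f0; apply: ZeroPath0.
Qed.

(** As [turn i] is injective, walks can also be compared backwards from a common end. *)
Lemma zero_path_backward i e f h : zero_path i e h -> zero_path i f h ->
  zero_path i e f \/ zero_path i f e.
Proof.
move=> eh; elim: eh f => [{}e|{}e {}h eh IH h0] f fh; first by right.
case: (zero_path_last fh) => [->|[g [fg g0 /turn_inj E]]].
  by left; apply: ZeroPathS.
by apply: IH; rewrite E.
Qed.

Lemma zero_path_porbit i e f : zero_path i e f -> f \in porbit (turn_perm i) e.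
Proof.
elim=> {e f} [e|e f _ IH _]; first exact: porbit_id.
by rewrite -turn_permE porbits_stable ?imset_f.
Qed.

Lemma zero_path_next i e : positive_on e ->
  zero_path i (turn i e) (next_edge w i e) /\ positive_on (next_edge w i e).
Proof.
move=> we; have [j [-> wj H]] := next_edgeP i we; split=> //.
elim: j H {wj} => [|j IHj] H; first exact: ZeroPath0.
apply: (@ZeroPathS _ _ (iter j.+1 (turn i) e)); last exact: H.
by apply: IHj => k kj; apply/H/ltnW.
Qed.

Lemma sigmaE i x : sigma w i x = next_tick i x.
Proof. exact: permE. Qed.

(** Tick marks of one edge are consecutive under [sigma], and the last one jumps along the orbit of
    turns over edges without tick marks. *)
Lemma porbit_sigma i x y : (y \in porbit (sigma w i) x)
  = (tick_edge y \in porbit (turn_perm i) (tick_edge x)).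
Proof.
apply/idP/idP=> [/porbitP[k ->]|].
  elim: k => [|k IHk]; first by rewrite expg0 perm1 porbit_id.
  rewrite expgSr permM sigmaE /next_tick; set z := ((sigma w i ^+ k)%g x) in IHk *.
  case: ifP => [zk|_]; first by rewrite tick_at_edge.
  have [j [-> wj _]] := next_edgeP i (tick_edge_gt0 z).
  rewrite tick_at_edge // -turn_permX; move: IHk; rewrite -eq_porbit_mem.
  by move/eqP <-; apply: mem_porbit.
(* Induction on the distance of the two tick marks along their edge. *)
have same_edge d u v : tick_edge u = tick_edge v -> tick_pos u + d = tick_pos v ->
    v \in porbit (sigma w i) u.
  elim: d u => [|d IHd] u uv Ed.
    by rewrite (tick_eq uv) ?porbit_id // -Ed addn0.
  have lv : tick_pos v < absz (w (tick_edge v)) by apply: ltn_ord.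
  have lu : (tick_pos u).+1 < absz (w (tick_edge u)) by rewrite uv; lia.
  have := IHd (sigma w i u); rewrite -eq_porbit_mem.
  have /= -> := porbit_perm (sigma w i) 1 u.
  rewrite eq_porbit_mem; apply; rewrite sigmaE /next_tick lu.
    by rewrite tick_at_edge.
  by rewrite tick_at_pos //; lia.
have same_edge' u v : tick_edge u = tick_edge v -> v \in porbit (sigma w i) u.
  move=> uv; case/orP: (leq_total (tick_pos u) (tick_pos v)) => luv.
    by apply: (same_edge _ _ _ uv (subnKC luv)).
  by rewrite porbit_sym; apply: (same_edge _ _ _ (esym uv) (subnKC luv)).
case/porbitP=> N; rewrite turn_permX.
(* Strong induction on the number of turns, since one jump of [sigma] may absorb several of them. *)
have [k] := ubnP N; elim: k => // k IHk in N x *; case: N => [|N] Nk yE.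
  exact/same_edge'/esym.
have wx := tick_edge_gt0 x.
(* [z] is the last tick mark on the edge of [x], the one from which [sigma] leaves this edge. *)
pose z := tick_at x (tick_edge x) (absz (w (tick_edge x))).-1.
have zl : (absz (w (tick_edge x))).-1 < absz (w (tick_edge x)) by rewrite prednK.
have zx : tick_edge z = tick_edge x by apply: tick_at_edge.
have [j [Ej wj H]] := next_edgeP i wx.
have sz : tick_edge (sigma w i z) = iter j.+1 (turn i) (tick_edge x).
  rewrite sigmaE /next_tick zx tick_at_pos // prednK // ltnn.
  by rewrite tick_at_edge ?Ej // -Ej.
have xz : z \in porbit (sigma w i) x by apply: same_edge'.
(* The edge of [y] carries a tick mark, so the jump cannot pass over it. *)
have jN : j <= N.
  by rewrite leqNgt; apply/negP=> /H; rewrite -yE tick_edge_gt0.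
have : y \in porbit (sigma w i) (sigma w i z).
  apply: (IHk (N - j)); first lia.
  by rewrite sz yE -iterD addnS subnK.
have /= E := porbit_perm (sigma w i) 1 z; rewrite E.
by move: xz; rewrite -eq_porbit_mem => /eqP->.
Qed.

Lemma ticks_porbit i x :
  ticks (porbit (turn_perm i) (tick_edge x)) = porbit (sigma w i) x.
Proof. by apply/setP=> y; rewrite inE porbit_sigma. Qed.

Lemma card_ticks C : #|ticks C| = \sum_(e in C) absz (w e).
Proof.
rewrite -sum1_card /=.
under [RHS]eq_bigr => e _ do rewrite -[absz _]card_ord -sum1_card.
rewrite sig_big_dep /=.
by apply: eq_bigl => x; rewrite inE andbT.
Qed.

End Ticks.
End Turns.

(** * Tropicalization of a positive weighting *)

Section Tropicalization.

Variables (m n r : nat) (G : mnr_ribbon_graph m n r).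
Implicit Types (e f : edge G) (C : {set edge G}) (p q : level (edge G) r).

Definition white_edges (k : 'I_m) : {set edge G} := [set e | in_white_face k e].
Definition gray_edges (k : 'I_n) : {set edge G} := [set e | in_gray_face k e].

(** Stage 0 turns left everywhere and so follows the boundary of the white face. *)
Lemma flabel_edge e f : (flabel (val e) == flabel (val f))
  = (f \in porbit (turn_perm G 0) e).
Proof.
have E k : val ((turn_perm G 0 ^+ k)%g e) = (fnext G ^+ k)%g (val e).
  elim: k => [|k IHk]; first by rewrite !expg0 !perm1.
  by rewrite !expgSr !permM -IHk turn_permE.
rewrite flabelP; apply/porbitP/porbitP=> -[k Ek]; exists k; last by rewrite Ek E.
by apply: val_inj; rewrite Ek E.
Qed.

(** Stage [r] turns right everywhere. On reversed darts this is the inverse of [fnext]: the boundary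
    of the gray face is followed backwards. *)
Lemma flabel_drev_edge e f : (flabel (drev G (val e)) == flabel (drev G (val f)))
  = (f \in porbit (turn_perm G r) e).
Proof.
have E k : drev G (val ((turn_perm G r ^+ k)%g e))
    = ((fnext G)^-1 ^+ k)%g (drev G (val e)).
  elim: k => [|k IHk]; first by rewrite !expg0 !perm1.
  rewrite !expgSr !permM -IHk turn_permE /turn ltnNge (ltn_ord (head_label _)) /=.
  by apply: (perm_inj (s := fnext G)); rewrite permKV permM drev_involutive permK.
rewrite flabelP -porbitV; apply/porbitP/porbitP=> -[k Ek]; exists k.
  by apply/val_inj/(perm_inj (s := drev G)); rewrite Ek E.
by rewrite Ek E.
Qed.

Lemma white_edge_exists k : exists e, in_white_face k e.
Proof.
have [x xk] := flabel_onto G (inl k); have wx : is_inl (flabel x) by rewrite xk.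
by exists (exist _ x wx); apply/eqP.
Qed.

Lemma gray_edge_exists k : exists e, in_gray_face k e.
Proof.
have [x xk] := flabel_onto G (inr k).
have wx : is_inl (flabel (drev G x)) by rewrite bicolored xk.
by exists (exist _ (drev G x) wx); apply/eqP; rewrite /= drev_involutive.
Qed.

Lemma white_edges_inj : injective white_edges.
Proof.
move=> k l /setP kl; have [e ek] := white_edge_exists k.
have := kl e; rewrite !inE ek => /esym; move: ek.
by rewrite /in_white_face => /eqP-> /eqP[].
Qed.

Lemma gray_edges_inj : injective gray_edges.
Proof.
move=> k l /setP kl; have [e ek] := gray_edge_exists k.
have := kl e; rewrite !inE ek => /esym; move: ek.
by rewrite /in_gray_face => /eqP-> /eqP[].
Qed.

Lemma porbits_turn0 : porbits (turn_perm G 0) = [set white_edges k | k : 'I_m].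
Proof.
have E e k : in_white_face k e -> porbit (turn_perm G 0) e = white_edges k.
  by move=> /eqP ek; apply/setP=> f; rewrite -flabel_edge inE ek eq_sym.
apply/setP=> C; apply/imsetP/imsetP=> -[].
  move=> e _ ->; have := valP e; case Ek: (flabel (val e)) => [k|//] _.
  by exists k => //; apply/E/eqP.
by move=> k _ ->; have [e ek] := white_edge_exists k; exists e => //; rewrite (E e k).
Qed.

Lemma porbits_turnr : porbits (turn_perm G r) = [set gray_edges k | k : 'I_n].
Proof.
have E e k : in_gray_face k e -> porbit (turn_perm G r) e = gray_edges k.
  by move=> /eqP ek; apply/setP=> f; rewrite -flabel_drev_edge inE ek eq_sym.
apply/setP=> C; apply/imsetP/imsetP=> -[].
  move=> e _ ->; have := bicolored (val e); rewrite (valP e).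
  case Ek: (flabel (drev G (val e))) => [//|k] _.
  by exists k => //; apply/E/eqP.
by move=> k _ ->; have [e ek] := gray_edge_exists k; exists e => //; rewrite (E e k).
Qed.

Lemma turn_perm_tperm (k : 'I_r) : exists a b,
  a != b /\ turn_perm G k.+1 = (turn_perm G k * tperm a b)%g.
Proof.
have [a [b [ab _ H]]] := out_edges G k; exists a, b; split=> //.
by apply/permP=> e; rewrite permM !turn_permE.
Qed.

(** The quotient of the two stages is the transposition of the two edges leaving vertex [k]. *)
Lemma touches_tail (k : 'I_r) C :
  touches (turn_perm G) k C = [exists e in C, tail_label e == k].
Proof.
have [a [b [ab tab H]]] := out_edges G k.
have E : turn_perm G k.+1 = (turn_perm G k * tperm a b)%g.
  by apply/permP=> e; rewrite permM !turn_permE.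
rewrite /touches E mulKg moves_tperm //; apply/orP/exists_inP.
  by case=> H'; [exists a|exists b]; rewrite // tab eqxx ?orbT.
by case=> e eC; rewrite tab => /orP[]/eqP<-; [left|right].
Qed.

Definition edge_graph : tgraph m n r :=
  perm_graph r (turn_perm G) white_edges gray_edges.

(** * Weightless walks in a positive weighting *)

Variable w : weighting G.
Hypothesis w_pos : positive_weighting w.

Lemma zero_tail_head e : ~~ positive_on w e -> tail_label e < head_label e.
Proof.
move=> w0; rewrite ltnNge; apply: contra w0 => /(proj2 w_pos).
by rewrite /positive_on lt0r absz_gt0 => /andP[].
Qed.

Lemma zero_path_tail i e f : zero_path w i e f -> tail_label e <= tail_label f.
Proof.
elim=> // {e f} e f _ ef /zero_tail_head/ltnW; rewrite tail_turn.
exact: leq_trans.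
Qed.

(** Tail labels increase strictly along weightless edges and stay below [r], so the walk must reach
    an edge with tick marks. *)
Lemma zero_path_exists i e : exists f, zero_path w i e f /\ positive_on w f.
Proof.
have [d] := ubnP (r - tail_label e); elim: d e => // d IHd e ed.
have [w0|w0] := boolP (positive_on w e).
  by exists e; split=> //; apply: ZeroPath0.
have [|f [ef fw]] := IHd (turn i e).
  have := zero_tail_head w0; rewrite tail_turn; have := ltn_ord (head_label e); lia.
exists f; split=> //; apply: zero_path_trans ef.
by apply: ZeroPathS w0; apply: ZeroPath0.
Qed.

Lemma turn_eq (k : 'I_r) e : head_label e != k -> turn k.+1 e = turn k e.
Proof.
rewrite -val_eqE /turn !ltnS /=.
by case: (ltngtP k (head_label e)) => // ->; rewrite eqxx.
Qed.

(** All turns of such a walk take place at labels greater than [k], where the two stages agree. *)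
Lemma zero_path_after (k : 'I_r) e f : k <= tail_label e ->
  zero_path w k e f -> zero_path w k.+1 e f.
Proof.
move=> ke ef; elim: ef ke => {e f} [e|e f ef IH f0] ke; first exact: ZeroPath0.
rewrite -turn_eq; first exact: ZeroPathS (IH ke) f0.
have kt : k <= tail_label f := leq_trans ke (zero_path_tail ef).
by rewrite -val_eqE neq_ltn (leq_ltn_trans kt (zero_tail_head f0)) orbT.
Qed.

(** All turns of such a walk take place at labels smaller than [k], where the two stages agree. *)
Lemma zero_path_before (k : 'I_r) e f : tail_label f < k ->
  zero_path w k e f -> zero_path w k.+1 e f.
Proof.
move=> fk ef; elim: ef fk => {e f} [e|e f ef IH f0] fk; first exact: ZeroPath0.
rewrite tail_turn in fk.
rewrite -turn_eq; last by rewrite -val_eqE neq_ltn fk.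
exact: ZeroPathS (IH (ltn_trans (zero_tail_head f0) fk)) f0.
Qed.

(** One of the two edges leads to the other by a weightless walk, and a nonempty one would strictly
    increase the tail label. *)
Lemma zero_path_out_eq i e f h : tail_label e = tail_label f ->
  zero_path w i e h -> zero_path w i f h -> e = f.
Proof.
have H a b : tail_label a = tail_label b -> zero_path w i a b -> a = b.
  move=> ab p; move: ab; case: p => // {}a {}b ab b0 E.
  have := zero_path_tail ab; have := zero_tail_head b0.
  by rewrite E tail_turn => /leq_trans H /H; rewrite ltnn.
move=> ef eh fh; case: (zero_path_backward eh fh) => p; first exact: H.
by apply/esym/H.
Qed.

(* If the tick mark preceding x lies on e, then a zero path joins turn k e to a
   and then a to the edge of x. At stage k.+1 it leaves vertex k along the other
   outgoing edge, from which the edge of x cannot be reached by a zero path. *)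
Lemma tau_first_tick (k : 'I_r) a (x : tick w) : tail_label a = k ->
  zero_path w k a (tick_edge x) -> tick_pos x = 0 -> tau w k x != x.
Proof.
move=> ak ax x0; apply/eqP; set y := ((sigma w k)^-1 x)%g.
have yx : sigma w k y = x by rewrite permKV.
rewrite /tau permM -/y => y'x; have gx := tick_edge_gt0 x.
have first i : sigma w i y = x -> next_edge w i (tick_edge y) = tick_edge x.
  rewrite sigmaE /next_tick => E.
  have [_ wn] := zero_path_next i (tick_edge_gt0 y).
  case: ifP E => [yl|_] E; first by move: x0; rewrite -E tick_at_pos.
  by rewrite -E tick_at_edge.
have [y_path _] := zero_path_next k (tick_edge_gt0 y).
have [y'_path _] := zero_path_next k.+1 (tick_edge_gt0 y).
move: y_path y'_path; rewrite (first _ yx) (first _ y'x) => yP y'P.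
(* Otherwise [a] would reach this edge through its predecessor, the edge of [y], which would have to
   be weightless. *)
have {}yP : zero_path w k (turn k (tick_edge y)) a.
  case: (zero_path_backward yP ax) => // p.
  case: (zero_path_last p) => [<-|[h [_ h0 /turn_inj E]]]; first exact: ZeroPath0.
  by move: h0; rewrite -E /positive_on tick_edge_gt0.
have [b [c [bc tbc Hbc]]] := out_edges G k.
have : exists2 d, zero_path w k.+1 (turn k.+1 (tick_edge y)) d &
    tail_label d = k /\ d <> a.
  have ne : tperm b c a <> a /\ tail_label (tperm b c a) = k.
    have := tbc a; rewrite ak eqxx => /esym/orP[]/eqP->.
      rewrite tpermL; split; first by apply/eqP; rewrite eq_sym.
      by apply/eqP; rewrite tbc eqxx orbT.
    rewrite tpermR; split; first exact/eqP.
    by apply/eqP; rewrite tbc eqxx.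
  exists (tperm b c a); last by case: ne.
  (* Before the turn onto [a], only vertices with labels below [k] are met, so stage [k.+1] repeats
     the walk and differs first at [k]. *)
  case: (zero_path_last yP) => [<-|[h [ph h0 Ea]]].
    by rewrite -Hbc; apply: ZeroPath0.
  have hk : tail_label h < k by rewrite -ak Ea tail_turn zero_tail_head.
  rewrite Ea -Hbc; apply: ZeroPathS h0; rewrite turn_eq.
    exact: zero_path_before.
  rewrite -val_eqE neq_ltn -(tail_turn k).
  by rewrite (leq_ltn_trans (zero_path_tail ph) hk).
case=> d yd [dk da]; apply: da; apply: (@zero_path_out_eq k.+1 _ _ (tick_edge x)).
- by rewrite dk ak.
- have [//|dx] := zero_path_forward yd y'P.
  have [<-|[]] := zero_path_inv dx; first exact: ZeroPath0.
  by rewrite /positive_on gx.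
by apply: zero_path_after => //; rewrite ak.
Qed.

(** * Orbits of edges and cycles of tick marks *)

Lemma porbits_ticks i C : C \in porbits (turn_perm G i) ->
  ticks w C \in porbits (sigma w i) /\ exists x : tick w, tick_edge x \in C.
Proof.
case/imsetP=> e _ ->; have [f [ef fw]] := zero_path_exists i e.
pose x : tick w := Tagged (fun e => 'I_(absz (w e))) (Ordinal fw).
have xe : tick_edge x \in porbit (turn_perm G i) e by apply: zero_path_porbit ef.
split; last by exists x.
by move: xe; rewrite -eq_porbit_mem => /eqP <-; rewrite ticks_porbit imset_f.
Qed.

Lemma ticks_onto i (c : {set tick w}) : c \in porbits (sigma w i) ->
  exists2 C, C \in porbits (turn_perm G i) & c = ticks w C.
Proof.
case/imsetP=> x _ ->; exists (porbit (turn_perm G i) (tick_edge x)).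
  exact: imset_f.
by rewrite ticks_porbit.
Qed.

Lemma ticks_inj i C D : C \in porbits (turn_perm G i) ->
  D \in porbits (turn_perm G i) -> ticks w C = ticks w D -> C = D.
Proof.
move=> Ci Di /setP CD; have [_ [x xC]] := porbits_ticks Ci.
by apply: (porbits_eq Ci Di xC); have := CD x; rewrite !inE xC.
Qed.

(** The search for the next tick mark never leaves [C], where the two turning rules agree. *)
Lemma sigma_eq_on i j C : C \in porbits (turn_perm G i) ->
    {in C, turn_perm G i =1 turn_perm G j} ->
  {in ticks w C, sigma w i =1 sigma w j}.
Proof.
move=> Ci Cij x; rewrite inE => xC.
have stab e : e \in C -> turn i e \in C.
  by rewrite -turn_permE porbits_stable.
have tij e : e \in C -> turn i e = turn j e by move/Cij; rewrite !turn_permE.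
have traj N e : e \in C -> traject (turn i) e N = traject (turn j) e N.
  by elim: N e => //= N IHN e eC; rewrite IHN ?stab // tij.
by rewrite !sigmaE /next_tick /next_edge traj ?stab // tij.
Qed.

(** If [C] leaves vertex [k] along [a], the first tick mark met from [a] on is moved by [tau].
    Otherwise both stages agree on [C], hence on its tick marks. *)
Lemma affected_ticks (k : 'I_r) C :
    (C \in porbits (turn_perm G k)) || (C \in porbits (turn_perm G k.+1)) ->
  affected k (ticks w C) = touches (turn_perm G) k C.
Proof.
move=> Ck; case: (boolP (touches _ _ _)) => tC.
  move: tC; rewrite touches_tail => /exists_inP[a aC /eqP ak].
  have [h [ah wh]] := zero_path_exists k a.
  pose x : tick w := Tagged (fun e => 'I_(absz (w e))) (Ordinal wh).
  apply/exists_inP; exists x; last exact: (@tau_first_tick k a x).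
  have stab i : C \in porbits (turn_perm G i) -> zero_path w i a h -> h \in C.
    move=> Ci /zero_path_porbit; case/imsetP: Ci aC => e _ ->.
    by rewrite -eq_porbit_mem => /eqP->.
  rewrite inE; case/orP: Ck => Ci; first exact: stab Ci ah.
  (* The walk was built at stage [k]; as it starts at vertex [k], it is also a walk at stage
     [k.+1]. *)
  by apply: stab Ci _; apply: zero_path_after; rewrite ?ak.
have {}Ck : C \in porbits (turn_perm G k).
  by case/orP: Ck => //; rewrite (unmoved_porbits tC).
have [Ts _] := porbits_ticks Ck; apply/negbTE.
by apply: eq_on_moves => //; apply: sigma_eq_on => //; apply: moves_eq_on.
Qed.

(** * Matching strands of edges with strands of tick marks *)

Definition tick_level p : stage w := (p.1, ticks w p.2).

Lemma tick_level_stage p : p \in level_orbits r (turn_perm G) ->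
  tick_level p \in stages w.
Proof. by rewrite !inE => /porbits_ticks[]. Qed.

Lemma stage_tick_level (P : stage w) : P \in stages w ->
  exists2 p, p \in level_orbits r (turn_perm G) & P = tick_level p.
Proof.
case: P => i c; rewrite inE /= => /ticks_onto[C Ci ->].
by exists (i, C); rewrite // inE.
Qed.

Lemma tick_level_inj :
  {in level_orbits r (turn_perm G) &, injective tick_level}.
Proof.
move=> [i C] [j D]; rewrite !inE /= => Ci Dj [ij CD].
by rewrite -ij in Dj *; rewrite (ticks_inj Ci Dj CD).
Qed.

Lemma same_cycle_persist p q : p \in level_orbits r (turn_perm G) ->
    q \in level_orbits r (turn_perm G) ->
  same_cycle (tick_level p) (tick_level q) ->
  persist (turn_perm G) p q.
Proof.
move: p q => [i C] [j D]; rewrite !inE /= => Ci Dj.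
case/and5P=> ps qs /eqP/= ji /eqP/= DC /forall_inP/= Eij.
have ir : i < r by have := ltn_ord j; rewrite ji ltnS.
have [Ts _] := porbits_ticks Ci.
have uC : ~~ touches (turn_perm G) (Ordinal ir) C.
  rewrite -affected_ticks ?Ci //; apply: eq_on_moves => // x xC.
  by have /eqP := Eij x xC; rewrite ji.
have CD : C = D.
  apply: (@ticks_inj j) => //; rewrite ji.
  by rewrite -(unmoved_porbits uC).
apply/persistP; split=> //= k; rewrite ji => H.
by have -> : nat_of_ord k = i by lia.
Qed.

Lemma persist_same_cycle (i j : 'I_r.+1) C : j = i.+1 :> nat ->
    C \in porbits (turn_perm G i) -> ~~ touches (turn_perm G) i C ->
  same_cycle (tick_level (i, C)) (tick_level (j, C)).
Proof.
move=> ji Ci uC; have Cj : C \in porbits (turn_perm G j).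
  by rewrite ji -(unmoved_porbits uC).
rewrite /same_cycle !tick_level_stage ?inE //= ji !eqxx /=.
apply/forall_inP=> x xC; apply/eqP; apply: sigma_eq_on xC => //.
exact: moves_eq_on.
Qed.

Lemma stage_equiv_sym : symmetric (@stage_equiv m n r G w).
Proof. by apply: sym_connect_sym => P Q; rewrite orbC. Qed.

(** Induction along the chain of generating steps, each stage of which comes from an orbit of
    edges. *)
Lemma stage_equiv_persist p (Q : stage w) : p \in level_orbits r (turn_perm G) ->
    stage_equiv (tick_level p) Q ->
  exists q, [/\ q \in level_orbits r (turn_perm G), Q = tick_level q &
                persist (turn_perm G) p q].
Proof.
move=> pL /connectP[S pS ->] {Q}; elim: S p pL pS => [|Q S IHS] p pL /=.
  by move=> _; exists p; rewrite persist_refl.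
case/andP=> pQ QS; have [q qL EQ] : exists2 q,
    q \in level_orbits r (turn_perm G) & Q = tick_level q.
  by apply: stage_tick_level; case/orP: pQ => /and5P[].
have pq : persist (turn_perm G) p q.
  rewrite EQ in pQ; case/orP: pQ => /same_cycle_persist; first by apply.
  by rewrite persist_sym; apply.
rewrite EQ in QS *; have [q' [q'L -> qq']] := IHS q qL QS.
by exists q'; split=> //; apply: persist_trans pq qq'.
Qed.

(** Climb from the lower level one transition at a time; each leaves the orbit untouched, hence its
    cycle of tick marks unchanged. *)
Lemma persist_stage_equiv p q : p \in level_orbits r (turn_perm G) ->
    q \in level_orbits r (turn_perm G) -> persist (turn_perm G) p q ->
  stage_equiv (tick_level p) (tick_level q).
Proof.
wlog: p q / p.1 <= q.1.
  move=> H pL qL; case/orP: (leq_total p.1 q.1) => pq; first exact: H.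
  by rewrite stage_equiv_sym persist_sym; apply: H.
move: p q => [i C] [j D] /= ij + _ /persistP[/= <- {D}].
rewrite (minn_idPl ij) (maxn_idPr ij).
have [d] := ubnP (j - i); elim: d => // d IHd in i ij *.
move=> ijd Ci H; have [Eij|nij] := eqVneq (i : nat) j.
  by rewrite (val_inj Eij); apply: connect0.
have ltij : i < j by rewrite ltn_neqAle nij.
have iK : (inord i.+1 : 'I_r.+1) = i.+1 :> nat.
  by apply: inordK; apply: leq_ltn_trans ltij (ltn_ord j).
have ir : i < r by have := ltn_ord j; rewrite ltnS; apply: leq_trans.
have uC : ~~ touches (turn_perm G) i C by apply: (H (Ordinal ir)); rewrite /= leqnn.
rewrite inE /= in Ci; have iC := persist_same_cycle iK Ci uC.
apply: (@connect_trans _ _ (tick_level (inord i.+1, C))).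
  by apply: connect1; rewrite iC.
apply: IHd; rewrite ?iK //; first lia.
  by rewrite inE /= iK -(unmoved_porbits uC).
by move=> k /andP[ik kj]; apply: H; rewrite kj ltnW.
Qed.

Lemma stage_equivE : {in level_orbits r (turn_perm G) &, forall p q,
  stage_equiv (tick_level p) (tick_level q) = persist (turn_perm G) p q}.
Proof.
move=> p q pL qL; apply/idP/idP; last exact: persist_stage_equiv.
case/(stage_equiv_persist pL) => q' [q'L E pq'].
by rewrite (tick_level_inj qL q'L E).
Qed.

Lemma tick_level_class p : p \in level_orbits r (turn_perm G) ->
  tick_level @: [set q in level_orbits r (turn_perm G) | persist (turn_perm G) p q]
    = [set Q in stages w | stage_equiv (tick_level p) Q].
Proof.
move=> pL; apply/setP=> Q; rewrite [in RHS]inE.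
apply/imsetP/andP=> [[q + ->]|[QL pQ]].
  rewrite inE => /andP[qL pq].
  by rewrite tick_level_stage // stage_equivE.
have [q [qL -> pq]] := stage_equiv_persist pL pQ.
by exists q; rewrite // inE qL.
Qed.

Fact tick_strand_subproof (a : tedge edge_graph) :
  tick_level @: val a \in equivalence_partition (@stage_equiv m n r G w) (stages w).
Proof.
have [p pL ->] := perm_strandP a; rewrite tick_level_class //.
by apply/imset_f/tick_level_stage.
Qed.

Definition tick_strand (a : tedge edge_graph) : strand w :=
  Sub (tick_level @: val a) (tick_strand_subproof a).

Lemma tick_strand_bij : bijective tick_strand.
Proof.
have inj : injective tick_strand.
  move=> a b /(congr1 val) /= ab; have [p pa] := strand_neq0 a.
  have : tick_level p \in tick_level @: val b by rewrite -ab imset_f.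
  case/imsetP=> q qb /tick_level_inj E; apply: (strand_eq pa).
  by rewrite E // (strand_level pa, strand_level qb).
have surj s : exists a, tick_strand a = s.
  have /imsetP[P /stage_tick_level[p pL ->] Es] := valP s.
  by exists (strand_of pL); apply: val_inj; rewrite /= Es tick_level_class.
have /fin_all_exists[h hK] := surj.
by exists h => // a; apply: inj.
Qed.

Lemma tick_strand_exists (a : tedge edge_graph) (P : pred (stage w))
    (Q : pred (level (edge G) r)) :
    (forall p, p \in level_orbits r (turn_perm G) -> P (tick_level p) = Q p) ->
  [exists x in val (tick_strand a), P x] = [exists p in val a, Q p].
Proof.
move=> PQ; apply/exists_inP/exists_inP=> [[x /imsetP[p pa ->]]|[p pa Qp]].
  by rewrite PQ ?(strand_level pa) //; exists p.
by exists (tick_level p); rewrite ?imset_f ?PQ ?(strand_level pa).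
Qed.

Lemma ticks_white k : ticks w (white_edges k) = white_cycle w k.
Proof. by apply/setP=> x; rewrite !inE. Qed.

Lemma ticks_gray k : ticks w (gray_edges k) = gray_cycle w k.
Proof. by apply/setP=> x; rewrite !inE. Qed.

Lemma tick_strand_starts a v :
  starts (t := tropicalization w) (tick_strand a) v = starts a v.
Proof.
case: v => [[k|k]|k] //=; apply: tick_strand_exists => -[i C] /=; rewrite inE /= => Ci.
  case: eqP => //= i0; rewrite i0 in Ci; apply/eqP/eqP=> [|->].
    by rewrite -ticks_white; apply: (ticks_inj Ci); rewrite porbits_turn0 imset_f.
  exact: ticks_white.
by case: eqP => //= ik; rewrite affected_ticks // -ik Ci orbT.
Qed.

Lemma tick_strand_ends a v :
  ends (t := tropicalization w) (tick_strand a) v = ends a v.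
Proof.
case: v => [[k|k]|k] //=; apply: tick_strand_exists => -[i C] /=; rewrite inE /= => Ci.
  case: eqP => //= ir; rewrite ir in Ci; apply/eqP/eqP=> [|->].
    by rewrite -ticks_gray; apply: (ticks_inj Ci); rewrite porbits_turnr imset_f.
  exact: ticks_gray.
by case: eqP => //= ik; rewrite affected_ticks // -ik Ci.
Qed.

Lemma tick_strand_weight a :
  tropical_weight w (tick_strand a) = (\sum_(e in strand_orbit a) w e)%R.
Proof.
rewrite ffunE /strand_length; case: pickP => [x /imsetP[p pa ->]|no].
  rewrite (strand_orbitE pa) card_ticks rmorph_sum /=; apply: eq_bigr => e _.
  (* An edge carries [absz (w e)] tick marks, which is [w e] by nonnegativity. *)
  by rewrite gez0_abs // (proj1 w_pos).
(* The default length 0 does not occur, as a strand is never empty. *)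
have [p pa] := strand_neq0 a; have := no (tick_level p).
by rewrite /= imset_f.
Qed.

End Tropicalization.

(** * Invariance of monodromy graphs under isomorphism *)

Section Isomorphism.

Variables (m n r : nat) (X Y : tgraph m n r).
Variables (wt : tweighting X) (wt' : tweighting Y).

Lemma isomorphic_weighted_sym :
  isomorphic_weighted wt wt' -> isomorphic_weighted wt' wt.
Proof.
case=> f [[h fK hK] fs fe fw]; exists h; split=> [|b v|b v|b].
- by exists f.
- by rewrite -fs hK.
- by rewrite -fe hK.
by rewrite -fw hK.
Qed.

Hypothesis iso : isomorphic_weighted wt wt'.

Lemma isomorphic_tropical : is_tropical X -> is_tropical Y.
Proof.
have [f [fbij fs fe fw]] := iso; have [h fK hK] := fbij.
have cardY (P : pred (tedge Y)) (Q : pred (tedge X)) :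
    (forall a, P (f a) = Q a) -> #|[set b | P b]| = #|[set a | Q a]|.
  move=> PQ; rewrite -(card_imset _ (bij_inj fbij)); apply: eq_card => b.
  rewrite inE -[b]hK PQ mem_imset ?inE //; exact: bij_inj.
have outY v : outdeg Y v = outdeg X v by apply: cardY.
have inY v : indeg Y v = indeg X v by apply: cardY.
case=> dig src snk inn acyc; split.
- move=> b; have [s1 e1] := dig (h b).
  by split; [rewrite -[RHS]s1|rewrite -[RHS]e1]; apply: eq_card => v;
    rewrite !inE -?fs -?fe hK.
- by move=> i; rewrite outY inY.
- by move=> j; rewrite outY inY.
- by move=> k; rewrite outY inY.
by move=> b i j; rewrite -[b]hK fs fe; apply: acyc.
Qed.

Lemma isomorphic_monodromy mu nu g :
  is_monodromy mu nu g wt -> is_monodromy mu nu g wt'.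
Proof.
have [f [fbij fs fe fw]] := iso; have [h fK hK] := fbij.
case=> -[trop Eg] w0 wmu wnu bal; split.
- by split=> //; apply: isomorphic_tropical.
- by move=> b; rewrite -[b]hK fw.
- by move=> b i; rewrite -[b]hK fs fw; apply: wmu.
- by move=> b i; rewrite -[b]hK fe fw; apply: wnu.
move=> k; rewrite !(reindex f) /=; try exact: onW_bij.
under eq_bigl => a do rewrite fe; under [RHS]eq_bigl => a do rewrite fs.
under eq_bigr => a _ do rewrite fw; under [RHS]eq_bigr => a _ do rewrite fw.
exact: bal.
Qed.

End Isomorphism.

(** * Euler relation and the linear map *)

Section MainTheorem.

Variables (m n r : nat) (G : mnr_ribbon_graph m n r).

(** Counting darts by vertices and by edges gives [4 * r] as twice the number of edges; there are
    [m + n] faces. *)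
Lemma euler_formula g : is_genus G g -> r + 2 = 2 * g + m + n.
Proof.
have rev2 x : #|porbit (drev G) x| = 2.
  have E : porbit (drev G) x = [set x; drev G x].
    apply/setP=> y; rewrite !inE; apply/porbitP/orP=> [[k ->]|[]/eqP->].
    - elim: k => [|k IHk]; first by left; rewrite expg0 perm1.
      rewrite expgSr permM; case: IHk => /eqP->; [right|left] => //.
      by rewrite drev_involutive.
    - by exists 0; rewrite expg0 perm1.
    by exists 1; rewrite expg1.
  by rewrite E cards2 eq_sym drev_free.
rewrite /is_genus.
have := card_uniform_porbits rev2.
rewrite (card_uniform_porbits (@four_valent _ _ _ G)).
rewrite (card_porbits_label (@vlabelP _ _ _ G) (@vlabel_onto _ _ _ G)).
rewrite (card_porbits_label (@flabelP _ _ _ G) (@flabel_onto _ _ _ G)).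
rewrite card_sum !card_ord; lia.
Qed.

(** The map $\varphi$ of the theorem, with the orbit of a strand as $S(e')$. *)
Definition edge_graph_weight (w : weighting G) : tweighting (edge_graph G) :=
  [ffun a : tedge (edge_graph G) => \sum_(e in strand_orbit a) w e : int^o]%R.

Lemma edge_graph_weight_linear : linear edge_graph_weight.
Proof.
move=> c u v; apply/ffunP=> a; rewrite !ffunE scaler_sumr -big_split /=.
by apply: eq_bigr => e _; rewrite !ffunE.
Qed.

HB.instance Definition _ := GRing.isLinear.Build int (weighting G)
  (tweighting (edge_graph G)) _ edge_graph_weight edge_graph_weight_linear.

End MainTheorem.

Theorem mainTheorem2 (m n r : nat) (hm : 1 <= m) (hn : 1 <= n) (hr : 1 <= r)
    (G : mnr_ribbon_graph m n r) (g : nat) (hg : is_genus G g) :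
  exists (T : tgraph m n r) (phi : {linear weighting G -> tweighting T}),
    [/\ is_tropical T,
        forall (d : nat) (mu : m.-tuple nat) (nu : n.-tuple nat),
          is_partition d mu -> is_partition d nu ->
          forall w : weighting G, positive_weighting w -> balanced_weighting mu nu w ->
            is_monodromy mu nu g (tropical_weight w) /\
            isomorphic_weighted (tropical_weight w) (phi w) &
        exists S : tedge T -> {set edge G},
          forall (w : weighting G) (e' : tedge T),
            (phi w e' = \sum_(e in S e') w e)%R].
Proof.
exists (edge_graph G), (@edge_graph_weight m n r G); split.
- apply: perm_graph_tropical (@turn_perm_tperm _ _ _ G) _ _ _ _.
  + exact: white_edges_inj.
  + exact: gray_edges_inj.
  + exact: porbits_turn0.
  + exact: porbits_turnr.
- move=> d mu nu _ _ w w_pos [w_mu w_nu].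
  have iso : isomorphic_weighted (edge_graph_weight w) (tropical_weight w).
    exists (tick_strand w_pos); split=> [|a v|a v|a].
    + exact: tick_strand_bij.
    + exact: tick_strand_starts.
    + exact: tick_strand_ends.
    by rewrite tick_strand_weight ffunE.
  split; last exact: isomorphic_weighted_sym.
  (* The monodromy conditions are checked on the fixed graph and carried over to the
     tropicalization. *)
  apply: (isomorphic_monodromy iso).
  apply: (perm_graph_monodromy (f := w) (@turn_perm_tperm _ _ _ G)
    (@white_edges_inj _ _ _ G) (@gray_edges_inj _ _ _ G)
    (porbits_turn0 G) (porbits_turnr G)).
  + exact: euler_formula hg.
  + exact: (proj1 w_pos).
  + by move=> k; rewrite -w_mu; apply: eq_bigl => e; rewrite inE.
  by move=> k; rewrite -w_nu; apply: eq_bigl => e; rewrite inE.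
by exists (@strand_orbit _ _ _) => w a; rewrite ffunE.
Qed.
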